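(* Let $\delta\in(0,1)$, let $X\subset\mathbb{R}_+$ be a Borel set with $0\in X$ and $\bar x=\sup X<\infty$, and let $0<x_0\le\bar x$. For $x\in[0,1]$ define $$q^*(x)=\frac{2(1-\delta)}{4-2\delta+x-\sqrt{x(x+8)}},\qquad \rho(x)=\frac12+\frac18\left(x+\sqrt{x(x+8)}\right).$$ Then there exists a constant $L\in(0,1)$ such that $R^*(x_0,\mathcal F_X)\ge\rho(x_0/\bar x)>1/2$ whenever $x_0/\bar x\ge L$. Moreover, if $x_0/\bar x\ge 1/6$, then the stationary decision rule $p^*$ given by $p^*(y)=q^*(y/\bar x)$ for each best-so-far alternative $y\in[x_0,\bar x]$ satisfies: (a) $p^*$ attains the performance ratio $\rho(x_0/\bar x)>1/2$, i.e. $R_{p^*}(x_0,\mathcal F_X)=\rho(x_0/\bar x)$; (b) if $1/6\le x_0/\bar x\le\delta^2/(2-\delta)$, then $p^*$ is dynamically robust for $(x_0,\mathcal F_X)$.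
   Context: Sequential search model. Fix a discount factor $\delta\in(0,1)$, a Borel set $X\subset\mathbb{R}_+$ with $0\in X$, and an outside option $x_0>0$. Let $\mathcal F_X$ be the set of all Borel probability distributions on $X$ with finite mean (''environments''); a set of feasible environments is any $\mathcal F\subset\mathcal F_X$. A history is $h_t=(x_0,x_1,\dots,x_t)$, $t\ge 0$, $x_i\in X$; its best-so-far alternative is $y_t=\max\{x_0,\dots,x_t\}$; $\mathcal H(x_0)$ is the set of all such histories. A decision rule $p$ assigns to each history $h$ a stopping probability $p(h)\in[0,1]$; it is stationary if $p(h)$ depends on $h$ only through its best-so-far alternative, written $p(y)$. Given an environment $F$ and a history $h_t$, the future alternatives are i.i.d. with law $F$; at each round $s\ge t$ the individual stops with probability $p(h_s)$ (otherwise observes the next alternative), and stopping at round $s$ yields $\delta^{s-t}y_s$ (never stopping yields $0$). $U_p(F,h_t)$ is the expected payoff, and $V(F,h)=\sup_pU_p(F,h)$. A prior is a finitely supported probability distribution $\mu$ on $\mathcal F$; $\Delta(\mathcal F)$ is the set of priors. An environment or prior is consistent with $h_t$ if $x_1,\dots,x_t$ occurs with positive probability under it; $\mathcal F(h)$, $\Delta(\mathcal F(h))$ denote the consistent ones. For consistent $\mu$, $U_p(\mu,h)=\sum_F\mu(F\mid h)U_p(F,h)$ with $\mu(\cdot\mid h)$ the Bayesian posterior, and $V(\mu,h)=\sup_pU_p(\mu,h)$. The performance ratio is $R_p(x_0,\mathcal F)=\inf_{h\in\mathcal H(x_0)}\inf_{\mu\in\Delta(\mathcal F(h))}U_p(\mu,h)/V(\mu,h)$,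 $R^*(x_0,\mathcal F)=\sup_pR_p(x_0,\mathcal F)$ over all decision rules, and $p$ is dynamically robust if $R_p(x_0,\mathcal F)=R^*(x_0,\mathcal F)$. *)

(* Defs.v *)
From HB Require Import structures.
From mathcomp Require Import all_boot all_order all_algebra.
From mathcomp Require Import all_classical all_reals all_analysis.
Set Implicit Arguments. Unset Strict Implicit. Unset Printing Implicit Defensive.
Import Order.TTheory GRing.Theory Num.Theory.
Local Open Scope classical_set_scope.
Local Open Scope ring_scope.

Section SearchModel.
Variable R : realType.

(* Environments are Borel probability measures on R (the canonical
   measurable structure on R is the Borel sigma-algebra). *)
Definition distr := probability R R.

Definition environment (X : set R) (F : distr) : Prop :=
  F (~` X) = 0%E /\ F.-integrable setT (fun x : R => x%:E).

Definition env_all (X : set R) : set distr := environment X.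

(* A history h_t = (x_0, x_1, ..., x_t) is the list [:: x_0; x_1; ...; x_t]. *)
Definition best_so_far (h : seq R) : R := \big[Num.max/0]_(x <- h) x.

Definition history (X : set R) (x0 : R) (h : seq R) : Prop :=
  exists xs : seq R, h = x0 :: xs /\ all (fun x => `[< X x >]) xs.

Definition decision_rule (p : seq R -> R) : Prop :=
  forall h, 0 <= p h <= 1.

Definition stationary_rule (q : R -> R) : seq R -> R :=
  fun h => q (best_so_far h).

Variable delta : R.

(* Truncated expected payoff: expected payoff of rule p from history h when
   the individual only gets paid if she stops within the next k rounds
   (not stopping by then yields 0). *)
Fixpoint trunc_payoff (p : seq R -> R) (F : distr) (k : nat) (h : seq R)
  : \bar R :=
  match k with
  | 0 => (p h * best_so_far h)%:E
  | k.+1 => ((p h * best_so_far h)%:E +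
             ((1 - p h) * delta)%:E *
               \int[F]_(x in setT) trunc_payoff p F k (rcons h x))%E
  end.

(* U_p(F,h): expected payoff (the increasing limit = supremum of the
   truncated payoffs). *)
Definition payoff (p : seq R -> R) (F : distr) (h : seq R) : R :=
  fine (ereal_sup (range (fun k => trunc_payoff p F k h))).

Definition likelihood (F : distr) (h : seq R) : R :=
  \prod_(x <- behead h) fine (F [set x]).

Definition prior (Fs : set distr) (mu : seq (R * distr)) : Prop :=
  all (fun wF => `[< 0 <= wF.1 /\ Fs wF.2 >]) mu /\
  \sum_(wF <- mu) wF.1 = 1.

Definition prior_likelihood (mu : seq (R * distr)) (h : seq R) : R :=
  \sum_(wF <- mu) wF.1 * likelihood wF.2 h.

Definition consistent (mu : seq (R * distr)) (h : seq R) : Prop :=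
  0 < prior_likelihood mu h.

(* U_p(mu,h) = sum_F mu(F|h) U_p(F,h) with the Bayesian posterior. *)
Definition payoff_prior (p : seq R -> R) (mu : seq (R * distr)) (h : seq R)
  : R :=
  (\sum_(wF <- mu) wF.1 * likelihood wF.2 h * payoff p wF.2 h)
    / prior_likelihood mu h.

Definition value_prior (mu : seq (R * distr)) (h : seq R) : R :=
  fine (ereal_sup [set (payoff_prior p mu h)%:E | p in decision_rule]).

Definition perf_ratio (p : seq R -> R) (X : set R) (x0 : R)
  (Fs : set distr) : \bar R :=
  ereal_inf [set r | exists (h : seq R) (mu : seq (R * distr)),
    [/\ history X x0 h, prior Fs mu, consistent mu h &
        r = (payoff_prior p mu h / value_prior mu h)%:E]].

Definition opt_ratio (X : set R) (x0 : R) (Fs : set distr) : \bar R :=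
  ereal_sup [set perf_ratio p X x0 Fs | p in decision_rule].

Definition dynamically_robust (p : seq R -> R) (X : set R) (x0 : R)
  (Fs : set distr) : Prop :=
  perf_ratio p X x0 Fs = opt_ratio X x0 Fs.

End SearchModel.

Definition qstar (R : realType) (delta x : R) : R :=
  2 * (1 - delta) / (4 - 2 * delta + x - Num.sqrt (x * (x + 8))).

Definition rho (R : realType) (x : R) : R :=
  1 / 2 + (x + Num.sqrt (x * (x + 8))) / 8.

(* Main.v *)
Require Import Defs.
From HB Require Import structures.
From mathcomp Require Import all_boot all_order all_algebra.
From mathcomp Require Import all_classical all_reals all_analysis.
From mathcomp Require Import measurable_realfun ring lra.
Import Order.TTheory GRing.Theory Num.Theory.
Import numFieldNormedType.Exports.
Local Open Scope classical_set_scope.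
Local Open Scope ring_scope.

(* Normalise [sup X = 1] and write [r = rho y], [w = 2 r - 1], so that
   [w^2 = r y] and [q = qstar y = r (1 - delta) / (1 - delta r)].

   Lower bound.  Let [c = delta E max(X, c)] be the reservation value of an
   environment.  No rule earns more than [max(y, c)].  The function
   [g y = rho y * max(y, c)] is a subsolution of the Bellman equation of the
   stationary rule: replacing [g (max y z)] by its minorant
   [g y + B (max(z, c) - c)], affine in [max(z, c)], turns the Bellman inequality
   into an identity.  That minorant is valid exactly because of a polynomial
   inequality that holds for [w >= 1/3], i.e. [y >= 1/6].  Hence the rule earns
   at least [g y] in each environment, and averaging over the posterior gives the
   ratio [rho x0].

   Upper bound.  If all alternatives are 0, the rule earns exactly [rho x0 * x0].
   For an arbitrary rule, consider also the environment that yields [v], close to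
   [sup X], with probability [theta] and 0 otherwise.  After zeros only, the
   payoffs in both environments satisfy linear recursions, and a weighted sum of
   them with constant weights rules out a ratio above [rho x0] for a suitable
   [theta], which is at most 1 iff [x0 <= delta^2 / (2 - delta)]. *)

(** * Algebra of [rho] and [qstar] *)

Section Rho.
Context {R : realType}.
Implicit Types (x y z c w W : R).

(** [rho x] is the larger root of [4 r^2 - (4 + x) r + 1 = 0], whose discriminant is [x (x + 8)].
    This polynomial relation replaces the square root in most arguments below. *)
Lemma rho_quadratic x : 0 <= x -> (2 * rho x - 1) ^+ 2 = rho x * x.
Proof.
move=> x0; have := @sqr_sqrtr R (x * (x + 8)).
rewrite mulr_ge0 ?addr_ge0// => /(_ erefl).
by rewrite /rho; set s := Num.sqrt _ => s2; nra.
Qed.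

Lemma rho_le {x y} : 0 <= x -> x <= y -> rho x <= rho y.
Proof.
move=> x0 xy; rewrite /rho lerD2l ler_pM2r ?invr_gt0// lerD// ler_sqrt.
  by rewrite ler_pM ?addr_ge0// lerD2r.
by rewrite mulr_ge0 ?addr_ge0// (le_trans x0).
Qed.

Lemma rho1 : rho 1 = 1 :> R.
Proof.
rewrite /rho (_ : 1 * (1 + 8) = 3 ^+ 2 :> R); last by ring.
by rewrite sqrtr_sqr ger0_norm//; field.
Qed.

Lemma half_lt_rho x : 0 < x -> 1 / 2 < rho x.
Proof. by move=> x0; rewrite /rho ltrDl divr_gt0// ltr_wpDr ?sqrtr_ge0. Qed.

Lemma rho_le1 x : 0 <= x -> x <= 1 -> rho x <= 1.
Proof. by move=> x0 x1; rewrite -rho1 rho_le. Qed.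

Lemma rho_lt1 x : 0 <= x -> x < 1 -> rho x < 1.
Proof.
move=> x0 x1; rewrite lt_neqAle rho_le1 ?(ltW x1)//= andbT.
by apply/eqP => r1; have := rho_quadratic _ x0; rewrite r1; nra.
Qed.

Lemma rho_ge x : 1 / 6 <= x -> 2 / 3 <= rho x.
Proof.
move=> x16; apply: (@le_trans _ _ (rho (1 / 6))); last by rewrite rho_le; lra.
rewrite /rho (_ : 1 / 6 * (1 / 6 + 8) = (7 / 6) ^+ 2 :> R); last by field.
rewrite sqrtr_sqr ger0_norm; last by lra.
by rewrite le_eqVlt; apply/orP; left; apply/eqP; field.
Qed.

(** The right-hand side is the solution of [q + (1 - q) delta rho = rho]: if all further
    alternatives are worthless, stopping with this probability in each round earns exactly the
    fraction [rho x] of the best alternative. *)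
Lemma qstar_rho (delta : R) x : 0 < delta < 1 -> 0 <= x -> x <= 1 ->
  qstar delta x = rho x * (1 - delta) / (1 - delta * rho x).
Proof.
move=> /andP[d0 d1] x0 x1; have r1 := rho_le1 _ x0 x1.
have rg : 1 / 2 <= rho x by rewrite /rho lerDl divr_ge0// addr_ge0// sqrtr_ge0.
have D0 : 0 < 1 - delta * rho x by nra.
have es : Num.sqrt (x * (x + 8)) = 8 * rho x - 4 - x by rewrite /rho; field.
rewrite /qstar es.
have := rho_quadratic _ x0; set r := rho x in r1 rg D0 es * => q.
have -> : 4 - 2 * delta + x - (8 * r - 4 - x) = 2 * (1 - delta * r) / r.
  apply: (@mulIf _ r); first by apply/eqP; lra.
  by rewrite mulfVK ?gt_eqF//; nra.
by field; rewrite !gt_eqF; lra.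
Qed.

(* The condition is tight at [w = 1/3], [s = 1], and that is where the bound
   1/6 on [x0 / xbar] comes from. *)
Lemma discriminant_le {w W s} : 0 <= s -> s <= 1 -> 0 <= W -> W <= 1 ->
  s ^+ 2 * (1 + W) = 2 * W ^+ 2 -> 1 / 3 <= w -> 2 * w <= s * (1 + w) ->
  (2 * w - (1 + w) * s) ^+ 2 <= (1 - w) * (W - w) * s ^+ 2.
Proof.
move=> s0 s1 W0 W1 sW w3 ws.
have sh : 1 / 2 <= s by nra.
(* The difference is concave in [w]: it suffices to check 1/3 and s/(2-s). *)
pose f := fun w : R => (1 - w) * (W - w) * s ^+ 2 - (2 * w - (1 + w) * s) ^+ 2.
suff : 0 <= f w by rewrite /f subr_ge0.
(* At [e] the last hypothesis is an equality and the square in [f] vanishes. *)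
pose e := s / (2 - s).
have e2 : e * (2 - s) = s by rewrite /e mulfVK// gt_eqF//; lra.
have we : w <= e by nra.
(* This is [e <= W] in disguise. After squaring it reads [2 W^2 (1 + W) <= 4 W^2]. *)
have sW2 : s <= 2 * W / (1 + W).
  rewrite -(@ler_pXn2r _ 2%N) ?nnegrE//; last by rewrite divr_ge0//; lra.
  rewrite exprMn exprVn ler_pdivlMr; last by rewrite exprn_gt0; lra.
  have -> : s ^+ 2 * (1 + W) ^+ 2 = 2 * W ^+ 2 * (1 + W) by rewrite -sW; ring.
  by nra.
have {}sW2 : s * (1 + W) <= 2 * W by rewrite -ler_pdivlMr//; lra.
have eW : e <= W by nra.
have fe : 0 <= f e.
  have -> : f e = (1 - e) * (W - e) * s ^+ 2.
    have -> : f e = (1 - e) * (W - e) * s ^+ 2 - (e * (2 - s) - s) ^+ 2.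
      by rewrite /f; ring.
    by rewrite e2; ring.
  by rewrite !mulr_ge0 ?sqr_ge0//; lra.
have f3 : 0 <= f (1 / 3).
  (* Nonnegativity of [f (1 / 3)] means [k <= t]. The relation between [s] and [W] makes [t] the
     positive root of [2 u^2 - 3 s^4 u - 9 s^6], so it suffices that this quadratic is nonpositive
     at [k]. *)
  pose t := 3 * s ^+ 2 * W; pose k := 9 * s ^+ 2 - 8 * s + 2.
  have -> : f (1 / 3) = 2 / 9 * (t - k) by rewrite /f /t /k; field.
  have [kt|tk] := leP k t; first by lra.
  have ht : 2 * t ^+ 2 - 3 * s ^+ 4 * t - 9 * s ^+ 6 = 0.
    have -> : 2 * t ^+ 2 - 3 * s ^+ 4 * t - 9 * s ^+ 6 = 9 * s ^+ 4 * (2 * W ^+ 2 - s ^+ 2 * (1 + W)) by rewrite /t; ring.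
    by rewrite sW subrr mulr0.
  have hk : 2 * k ^+ 2 - 3 * s ^+ 4 * k - 9 * s ^+ 6 <= 0.
    (* The double root [s = 1] is the tight case. The other factor has nonnegative coefficients in
       [s - 1 / 2], and [s >= 1 / 2]. *)
    have -> : 2 * k ^+ 2 - 3 * s ^+ 4 * k - 9 * s ^+ 6 = - (4 * (s - 1) ^+ 2 *
        (9 * (s - 1 / 2) ^+ 4 + 30 * (s - 1 / 2) ^+ 3
         + 15 / 2 * (s - 1 / 2) ^+ 2 + 3 / 2 * (s - 1 / 2) + 1 / 16)).
      by rewrite /k; field.
    rewrite oppr_le0; apply: mulr_ge0; first by rewrite mulr_ge0 ?sqr_ge0.
    have : 0 <= s - 1 / 2 by lra.
    by move: (s - 1 / 2) => u u0; rewrite !addr_ge0 ?mulr_ge0 ?exprn_ge0//; lra.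
  have t0 : 0 < t by rewrite /t !mulr_gt0 ?exprn_gt0//; nra.
  have t2 : 0 <= t * (2 * t - 3 * s ^+ 4).
    have -> : t * (2 * t - 3 * s ^+ 4) = 9 * s ^+ 6 by lra.
    by rewrite mulr_ge0// exprn_ge0.
  have {}t2 : 0 <= 2 * t - 3 * s ^+ 4 by rewrite pmulr_rge0 in t2.
  by nra.
have [e3|e3] := leP e (1 / 3).
  by have -> : w = e by lra.
(* Interpolation of [f] between 1/3 and [e]; the remainder is nonnegative because the leading
   coefficient of [f] is [-4 (1 - s)]. *)
have : f w * (e - 1 / 3) = f e * (w - 1 / 3) + f (1 / 3) * (e - w)
    + 4 * (1 - s) * (e - 1 / 3) * (w - 1 / 3) * (e - w).
  by rewrite /f; field.
move=> fwe; rewrite -(@pmulr_lge0 _ (e - 1 / 3)) ?fwe; last by lra.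
by rewrite !addr_ge0 ?mulr_ge0//; lra.
Qed.

(** For [w = 2 * rho y - 1] and [W = 2 * rho z - 1] this is the nontrivial case of
    [rho_max_subsolution] with denominators cleared. Either both summands are nonnegative, or the
    sum is a square plus [c] times the difference controlled by [discriminant_le]. *)
Lemma key_poly w W z c : 1 / 3 <= w -> w <= W -> W <= 1 ->
  z * (1 + W) = 2 * W ^+ 2 -> 0 < c -> c <= z ->
  0 <= (1 - w) * (W - w) * z * c + (z - c) * (4 * w ^+ 2 - (1 + w) ^+ 2 * c).
Proof.
move=> w3 wW W1 zW c0 cz.
have z1 : z <= 1 by nra.
pose s := Num.sqrt z; have s0 : 0 <= s := sqrtr_ge0 _.
have sz : s ^+ 2 = z by rewrite sqr_sqrtr//; lra.
have s1 : s <= 1 by nra.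
have [ws|ws] := leP (s * (1 + w)) (2 * w).
  rewrite addr_ge0// !mulr_ge0//; try lra.
  have : (s * (1 + w)) ^+ 2 <= (2 * w) ^+ 2 by rewrite lerXn2r// nnegrE; nra.
  by rewrite exprMn sz; nra.
have /(_ s0 s1)h := @discriminant_le w W s.
have {}h : (2 * w - (1 + w) * s) ^+ 2 <= (1 - w) * (W - w) * s ^+ 2.
  by apply: h => //; [lra|rewrite sz|exact: ltW].
rewrite -sz.
have -> : (1 - w) * (W - w) * s ^+ 2 * c
    + (s ^+ 2 - c) * (4 * w ^+ 2 - (1 + w) ^+ 2 * c) = c * ((1 - w) * (W - w) * s ^+ 2
  - (2 * w - (1 + w) * s) ^+ 2) + (2 * w * s - (1 + w) * c) ^+ 2 by ring.
by rewrite addr_ge0 ?sqr_ge0// mulr_ge0 ?subr_ge0// ltW.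
Qed.

Lemma max_mono x y c : x <= y -> Num.max x c <= Num.max y c.
Proof. by move=> xy; rewrite ge_max !le_max xy lexx orbT. Qed.

(** The affine minorant, normalised. If [c <= y] or [z <= c], monotonicity of [rho] and of the
    maximum suffices; only [y < c < z] needs [key_poly]. *)
Lemma rho_max_subsolution y z c : 1 / 6 <= y <= 1 -> 0 <= z <= 1 -> 0 <= c ->
  rho y * Num.max y c
    + (if y < c then rho y * (c - y) / ((1 - rho y) * c) else 0)
      * (Num.max z c - c)
  <= rho (Num.max y z) * Num.max (Num.max y z) c.
Proof.
move=> /andP[y16 y1] /andP[z0 z1] c0.
have mono t : y <= t -> rho y * Num.max y c <= rho t * Num.max t c.
  move=> yt; apply: ler_pM; [have := rho_ge _ y16; lra| | |exact: max_mono].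
    by rewrite le_max c0 orbT.
  by rewrite rho_le//; lra.
have m1 := mono (Num.max y z); rewrite le_max lexx /= in m1.
case: ifPn => [yc|_]; last by rewrite mul0r addr0 m1.
have [zc|cz] := leP z c; first by rewrite subrr mulr0 addr0 m1.
have yz : y < z by lra.
rewrite (max_idPr (ltW yz)) (max_idPr (ltW yc)) (max_idPl (ltW cz)).
have r1 : rho y < 1 by rewrite rho_lt1; lra.
have r2 := rho_ge _ y16.
rewrite -lerBrDl mulrAC ler_pdivrMr; last by rewrite mulr_gt0; lra.
have qy : (2 * rho y - 1) ^+ 2 = rho y * y by rewrite rho_quadratic//; lra.
have qz : (2 * rho z - 1) ^+ 2 = rho z * z by rewrite rho_quadratic//; lra.
have rz1 : rho z <= 1 by rewrite rho_le1//; lra.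
have ryz : rho y <= rho z by rewrite rho_le//; lra.
have := @key_poly (2 * rho y - 1) (2 * rho z - 1) z c.
set r := rho y in r1 r2 qy ryz *; set r' := rho z in qz rz1 ryz *.
have h1 : 1 / 3 <= 2 * r - 1 by lra.
have h2 : 2 * r - 1 <= 2 * r' - 1 by lra.
have h3 : 2 * r' - 1 <= 1 by lra.
have h4 : z * (1 + (2 * r' - 1)) = 2 * (2 * r' - 1) ^+ 2 by rewrite qz; ring.
have h5 : 0 < c by lra.
move=> /(_ h1 h2 h3 h4 h5 (ltW cz)); rewrite qy; nra.
Qed.

End Rho.

(** * Integrals and reservation values *)

(* Decision rules need not be measurable, so the integrands below are arbitrary:
   the integral is then a supremum over smaller simple functions. *)
Section Integral.
Import HBNNSimple.
Context {d} {T : measurableType d} {R : realType} (mu : {measure set T -> \bar R}).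
Context {A : set T}.
Hypotheses (mA : measurable A) (muA : mu (~` A) = 0%E).
Implicit Types f g : T -> \bar R.
Local Open Scope ereal_scope.

Let le_integral_full0 f g : (forall x, 0 <= f x) -> (forall x, 0 <= g x) ->
  (forall x, A x -> f x <= g x) -> \int[mu]_x f x <= \int[mu]_x g x.
Proof.
move=> f0 g0 fg; rewrite !ge0_integralTE//.
apply: ge_ereal_sup => _ [h hf <-].
(* A simple function below [f], cut off outside [A], lies below [g] and has the same integral, since
   the complement of [A] is null. *)
pose hA := proj_nnsfun h mA.
have hAE x : hA x = (h \_ A) x by rewrite mrestrict.
apply: ereal_sup_ubound; exists hA.
  move=> x; rewrite hAE patchE; case: ifPn => [/set_mem xA|_] //.
  by rewrite (le_trans (hf x))// fg.
rewrite -!integralT_nnsfun; apply: ge0_ae_eq_integral => //.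
- exact/measurable_EFinP.
- exact/measurable_EFinP.
- by move=> x _; rewrite lee_fin.
- by move=> x _; rewrite lee_fin.
exists (~` A); split => //; first exact: measurableC.
move=> x /= hx Ax; apply: hx => _ /=.
by have := hAE x; rewrite patchE mem_set//= => ->.
Qed.

Lemma eq_integral_full f g : (forall x, A x -> f x = g x) ->
  \int[mu]_x f x = \int[mu]_x g x.
Proof.
move=> fg; rewrite integralE [RHS]integralE.
by congr (_ - _); apply/eqP; rewrite eq_le; apply/andP; split;
  apply: le_integral_full0 => // x Ax; rewrite ?funeposE ?funenegE fg.
Qed.

Lemma le_integral_full f g : (forall x, A x -> 0 <= f x) ->
  (forall x, A x -> f x <= g x) -> \int[mu]_x f x <= \int[mu]_x g x.
Proof.
move=> f0 fg.
rewrite (eq_integral_full f (f \_ A)); last by move=> x Ax; rewrite patchE mem_set.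
rewrite (eq_integral_full g (g \_ A)); last by move=> x Ax; rewrite patchE mem_set.
apply: le_integral_full0 => x; rewrite ?patchE.
- by case: ifPn => // /set_mem; exact: f0.
- by case: ifPn => // /set_mem Ax; rewrite (le_trans (f0 x Ax))// fg.
- by move=> Ax; rewrite mem_set// fg.
Qed.

End Integral.

Section Reservation.
Context {R : realType} (F : distr R).
Hypothesis iF : F.-integrable setT (fun x : R => x%:E).

Definition mean_max (c : R) : R := \int[F]_x Num.max x c.

Lemma integrable_max c : F.-integrable setT (fun x : R => (Num.max x c)%:E).
Proof.
have ic : F.-integrable setT (fun _ : R => `|c|%:E).
  exact: finite_measure_integrable_cst.
apply: le_integrable (integrableD measurableT (integrable_abse iF) ic) => //.
  apply/measurable_EFinP; exact: measurable_maxr.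
move=> x _ /=; rewrite lee_fin [leRHS]ger0_norm ?addr_ge0//.
by case: (leP x c) => _; rewrite ?lerDl ?lerDr.
Qed.

Lemma integral_affine_max a b c :
  (\int[F]_x (a + b * Num.max x c)%:E = (a + b * mean_max c)%:E)%E.
Proof.
have ic : F.-integrable setT (fun _ : R => a%:E).
  exact: finite_measure_integrable_cst.
have im : F.-integrable setT (fun x : R => (b * Num.max x c)%:E).
  exact: (integrableZl measurableT b (integrable_max c)).
rewrite (_ : (fun x => _) = (fun x => a%:E + (b * Num.max x c)%:E)%E)//.
rewrite integralD//= integral_cst//  [X in (_ * X)%E]probability_setT mule1 EFinD; congr (_ + _)%E.
under eq_integral do rewrite EFinM.
rewrite integralZl ?integrable_max// EFinM; congr (_ * _)%E.
rewrite /mean_max /Rintegral fineK//.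
exact: integrable_fin_num (integrable_max c).
Qed.

(** The maximum is 1-Lipschitz in each argument. Consequently, above the reservation value waiting
    one more round does not pay. *)
Lemma mean_max_le c m : c <= m -> mean_max m <= m - c + mean_max c.
Proof.
move=> cm; rewrite -lee_fin -[mean_max c]mul1r -integral_affine_max.
rewrite -[mean_max m]add0r -[mean_max m]mul1r -integral_affine_max.
apply: le_integral => //.
- rewrite (_ : (fun x => _) = (fun x => (Num.max x m)%:E)) ?integrable_max//.
  by apply/funext => x; rewrite add0r mul1r.
- rewrite (_ : (fun x => _) = (fun x => ((m - c)%:E + (Num.max x c)%:E)%E)).
    apply: integrableD (integrable_max c) => //.
    exact: finite_measure_integrable_cst.
  by apply/funext => x; rewrite mul1r.
- move=> x _; rewrite lee_fin add0r !mul1r.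
  by case: (leP x m); case: (leP x c); lra.
Qed.

Lemma mean_max_mono c m : c <= m -> mean_max c <= mean_max m.
Proof.
move=> cm; apply: le_Rintegral => //; [exact: integrable_max..|].
by move=> x _; rewrite ge_max !le_max lexx cm orbT.
Qed.

(* Knaster-Tarski for the monotone map [c |-> delta * E max(X, c)]. *)
Lemma reservation_value (delta b : R) (X : set R) : 0 < delta < 1 ->
  measurable X -> X `<=` [set x | 0 <= x <= b] -> 0 <= b -> F (~` X) = 0%E ->
  exists2 c, 0 <= c <= b & delta * mean_max c = c.
Proof.
move=> /andP[d0 d1] mX X0b b0 FX.
have mb c : 0 <= c <= b -> 0 <= mean_max c <= b.
  move=> /andP[c0 cb].
  rewrite -!lee_fin -[mean_max c]mul1r -[1 * _]add0r -integral_affine_max.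
  rewrite integral_ge0/=; last first.
    by move=> x _; rewrite lee_fin add0r mul1r le_max c0 orbT.
  have -> : b%:E = (\int[F]_x (b + 0 * Num.max x c)%:E)%E.
    by rewrite integral_affine_max mul0r addr0.
  apply: (le_integral_full F mX FX) => x Xx; rewrite lee_fin add0r mul1r.
    by rewrite le_max c0 orbT.
  by have /andP[? ?] := X0b x Xx; rewrite mul0r addr0 ge_max; apply/andP.
pose S := [set c : R | 0 <= c <= b /\ c <= delta * mean_max c].
have S0 : S 0.
  split; first by rewrite lexx.
  rewrite mulr_ge0 ?(ltW d0)//; by have /andP[] := mb 0 ltac:(by rewrite lexx b0).
have Sb : has_sup S by split; [exists 0|exists b => c [/andP[]]].
have s0 : 0 <= sup S by apply: ub_le_sup => //; case: Sb.
have sb : sup S <= b by apply: ge_sup; [exists 0|move=> c [/andP[]]].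
exists (sup S); first exact/andP.
have sle : sup S <= delta * mean_max (sup S).
  apply: ge_sup; first by exists 0.
  move=> c Sc; have [_ /le_trans] := Sc; apply.
  rewrite ler_pM2l// mean_max_mono// ub_le_sup//; by case: Sb.
apply/eqP; rewrite eq_le sle andbT; apply: ub_le_sup; first by case: Sb.
have /andP[m0 m1] : 0 <= mean_max (sup S) <= b by apply/mb/andP.
split; last by rewrite ler_pM2l// mean_max_mono.
by rewrite mulr_ge0 ?(ltW d0)//=; nra.
Qed.

End Reservation.

(** * Best-so-far alternatives along histories *)

Section Best.
Context {R : realType}.
Implicit Types (h : seq R) (x : R).

Lemma best_ge0 h : 0 <= best_so_far h.
Proof.
by rewrite /best_so_far; elim: h => [|x h IH]; rewrite ?big_nil// big_cons le_max IH orbT.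
Qed.

Lemma best_rcons h x : 0 <= x -> best_so_far (rcons h x) = Num.max (best_so_far h) x.
Proof.
move=> x0; rewrite /best_so_far.
elim: h => [|y h IH] /=; first by rewrite big_cons !big_nil maxC.
by rewrite !big_cons IH maxA.
Qed.

Context {X : set R} {x0 : R}.

Lemma history_rcons {h x} : history X x0 h -> X x -> history X x0 (rcons h x).
Proof.
move=> [xs [-> Xxs]] Xx; exists (rcons xs x); split => //.
by rewrite all_rcons Xxs andbT; apply/asboolP.
Qed.

Lemma history_best {b h} : 0 < x0 <= b -> X `<=` [set x | 0 <= x <= b] ->
  history X x0 h -> x0 <= best_so_far h <= b.
Proof.
move=> /andP[x00 x0b] X0b [xs [-> Xxs]]; rewrite /best_so_far big_cons.
rewrite le_max lexx/= ge_max x0b/=.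
elim: xs Xxs => [_|x xs IH]/=; first by rewrite big_nil (le_trans _ x0b)// ltW.
move=> /andP[/asboolP Xx /IH ?]; rewrite big_cons ge_max; apply/andP; split => //.
by have /andP[] := X0b x Xx.
Qed.

End Best.

(** * Payoffs and performance ratios *)

Section Payoff.
Context {R : realType} (delta : R).
Hypothesis d01 : 0 < delta < 1.
Context {X : set R}.
Hypothesis mX : measurable X.
Context {x0 b : R}.
Hypotheses (x0b : 0 < x0 <= b) (X0b : X `<=` [set x | 0 <= x <= b]).
Implicit Types (p q : seq R -> R) (F : distr R) (h : seq R)
  (mu : seq (R * distr R)).

Let d0 : 0 <= delta. Proof. by case/andP: d01 => /ltW. Qed.
Let b0 : 0 <= b. Proof. by have /andP[/ltW/le_trans] := x0b; apply. Qed.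

(** Environments charge only [X], so a history in [X] almost surely continues in [X], and the values
    of a rule elsewhere do not affect payoffs. *)
Lemma eq_trunc_payoff {p q F} k h :
  (forall h, history X x0 h -> p h = q h) -> environment X F ->
  history X x0 h -> trunc_payoff delta p F k h = trunc_payoff delta q F k h.
Proof.
move=> pq [FX _]; elim: k h => [|k IH] h Hh /=; rewrite pq//.
congr (_ + _ * _)%E; apply: (eq_integral_full F mX FX) => x Xx.
exact/IH/history_rcons.
Qed.

Lemma prior_all {mu} : prior (env_all X) mu ->
  forall wF, wF \in mu -> 0 <= wF.1 /\ environment X wF.2.
Proof. by move=> [/allP mu0 _] wF /mu0 /asboolP. Qed.

(** Allows a stopping formula to be replaced by a genuine decision rule that agrees with it on the
    histories in [X]. *)
Lemma eq_perf_ratio p q : (forall h, history X x0 h -> p h = q h) ->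
  perf_ratio delta p X x0 (env_all X) = perf_ratio delta q X x0 (env_all X).
Proof.
move=> pq; have pqE h mu : history X x0 h -> prior (env_all X) mu ->
    payoff_prior delta p mu h = payoff_prior delta q mu h.
  move=> Hh Pmu; rewrite /payoff_prior; congr (_ / _); apply: eq_big_seq => wF wFmu.
  have [_ eF] := prior_all Pmu _ wFmu; rewrite /payoff.
  suff -> : (fun k => trunc_payoff delta p wF.2 k h)
    = (fun k => trunc_payoff delta q wF.2 k h) by [].
  by apply/funext => k; exact: eq_trunc_payoff.
rewrite /perf_ratio; congr ereal_inf; apply/seteqP; split => _ [h [mu [? ? ? ->]]].
  by exists h, mu; split => //; rewrite pqE.
by exists h, mu; split => //; rewrite pqE.
Qed.

Lemma trunc_payoff_ge0 {p} : decision_rule p ->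
  forall F k h, (0 <= trunc_payoff delta p F k h)%E.
Proof.
move=> dp F; elim=> [|k IH] h /=; have /andP[p0 p1] := dp h.
  by rewrite lee_fin mulr_ge0// best_ge0.
rewrite adde_ge0 ?lee_fin ?mulr_ge0 ?best_ge0// mule_ge0 ?integral_ge0//.
by rewrite lee_fin mulr_ge0// subr_ge0.
Qed.

(** [max y c] is a supersolution of the Bellman equation of every rule: stopping yields [y <= m],
    and [delta * mean_max F m <= m] for [m >= c] by [mean_max_le]. *)
Lemma trunc_payoff_ub {p F c} : decision_rule p -> environment X F -> 0 <= c ->
  delta * mean_max F c = c -> forall k h, history X x0 h ->
  (trunc_payoff delta p F k h <= (Num.max (best_so_far h) c)%:E)%E.
Proof.
move=> dp [FX iF] c0 cE; elim=> [|k IH] h Hh /=; have /andP[p0 p1] := dp h;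
  have y0 := best_ge0 h; set y := best_so_far h in y0 *; set m := Num.max y c.
  rewrite lee_fin (le_trans (_ : _ <= y))// ?le_max ?lexx// ler_piMl//.
have ym : y <= m by rewrite le_max lexx.
have cm : c <= m by rewrite le_max lexx orbT.
have IHm : (\int[F]_x trunc_payoff delta p F k (rcons h x)
    <= (mean_max F m)%:E)%E.
  rewrite -[mean_max F m]mul1r -[1 * _]add0r -integral_affine_max//.
  apply: (le_integral_full F mX FX) => x Xx; first exact: trunc_payoff_ge0.
  rewrite (le_trans (IH _ (history_rcons Hh Xx)))// lee_fin.
  have /andP[xx0 _] := X0b x Xx.
  by rewrite best_rcons// add0r mul1r /m maxA (maxC x).
have dm : delta * mean_max F m <= m.
  have := mean_max_le F iF c m cm; case/andP: d01 => ? ?; nra.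
apply: (@le_trans _ _ ((p h * y)%:E + ((1 - p h) * delta)%:E * (mean_max F m)%:E)%E).
  by rewrite leeD2l// lee_wpmul2l// lee_fin mulr_ge0// subr_ge0.
rewrite -EFinM -EFinD lee_fin -mulrA.
have : (1 - p h) * (delta * mean_max F m) <= (1 - p h) * m.
  by rewrite ler_wpM2l// subr_ge0.
have : p h * y <= p h * m by rewrite ler_wpM2l.
lra.
Qed.

Lemma environment_reservation F : environment X F ->
  exists2 c, 0 <= c <= b & delta * mean_max F c = c.
Proof. by move=> [FX iF]; exact: (reservation_value F iF _ _ X). Qed.

Lemma trunc_payoff_le {p F} : decision_rule p -> environment X F ->
  forall k h, history X x0 h -> (trunc_payoff delta p F k h <= b%:E)%E.
Proof.
move=> dp eF k h Hh; have [c /andP[c0 cb] cE] := environment_reservation F eF.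
rewrite (le_trans (trunc_payoff_ub dp eF c0 cE k h Hh))// lee_fin ge_max cb andbT.
by have /andP[] := history_best x0b X0b Hh.
Qed.

(** [fine] would send an infinite supremum to 0; the bound [b] on truncated payoffs excludes
    this. *)
Lemma payoffE {p F h} : decision_rule p -> environment X F -> history X x0 h ->
  (payoff delta p F h)%:E
    = ereal_sup (range (fun k => trunc_payoff delta p F k h)).
Proof.
move=> dp eF Hh; rewrite /payoff fineK// fin_numE; apply/andP; split.
  rewrite gt_eqF// (lt_le_trans ltNy0)//.
  by rewrite (le_trans (trunc_payoff_ge0 dp F 0%N h))//; apply: ereal_sup_ubound; exists 0%N.
rewrite lt_eqF// (le_lt_trans (_ : _ <= b%:E)%E) ?ltry//.
by apply: ge_ereal_sup => _ [k _ <-]; exact: trunc_payoff_le.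
Qed.

Lemma trunc_payoff_le_payoff {p F h} k : decision_rule p -> environment X F ->
  history X x0 h -> (trunc_payoff delta p F k h <= (payoff delta p F h)%:E)%E.
Proof.
by move=> dp eF Hh; rewrite payoffE//; apply: ereal_sup_ubound; exists k.
Qed.

Lemma payoff_le {p F h} (r : R) : decision_rule p -> environment X F ->
  history X x0 h -> (forall k, trunc_payoff delta p F k h <= r%:E)%E ->
  payoff delta p F h <= r.
Proof.
move=> dp eF Hh tr; rewrite -lee_fin payoffE//.
by apply: ge_ereal_sup => _ [k _ <-].
Qed.

Lemma payoff_ge0 {p F h} : decision_rule p -> environment X F ->
  history X x0 h -> 0 <= payoff delta p F h.
Proof.
move=> dp eF Hh; rewrite -lee_fin.
exact: le_trans (trunc_payoff_ge0 dp F 0%N h) (trunc_payoff_le_payoff _ dp eF Hh).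
Qed.

Lemma stop_decision : decision_rule (fun _ : seq R => 1).
Proof. by move=> h; rewrite lexx ler01. Qed.

Lemma payoff_stop {F h} : environment X F -> history X x0 h ->
  best_so_far h <= payoff delta (fun _ => 1) F h.
Proof.
move=> eF Hh; have := trunc_payoff_le_payoff 0%N stop_decision eF Hh.
by rewrite /= mul1r lee_fin.
Qed.

Lemma likelihood_ge0 F h : 0 <= likelihood F h.
Proof. by apply: prodr_ge0 => x _; rewrite fine_ge0. Qed.

(** The posterior weights do not depend on the rule, so a comparison valid in every environment
    survives averaging. *)
Lemma payoff_prior_le p q mu h (k : R) : prior (env_all X) mu ->
  consistent mu h ->
  (forall F, environment X F -> payoff delta p F h <= k * payoff delta q F h) ->
  payoff_prior delta p mu h <= k * payoff_prior delta q mu h.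
Proof.
move=> Pmu cmu pq; rewrite /payoff_prior mulrA ler_pM2r ?invr_gt0//.
rewrite mulr_sumr; rewrite big_seq [leRHS]big_seq; apply: ler_sum => wF wFmu.
have [w0 eF] := prior_all Pmu _ wFmu.
rewrite [leRHS]mulrCA ler_wpM2l ?mulr_ge0 ?likelihood_ge0//; exact: pq.
Qed.

Lemma best_le_payoff_prior_stop mu h : prior (env_all X) mu ->
  history X x0 h -> consistent mu h ->
  best_so_far h <= payoff_prior delta (fun _ => 1) mu h.
Proof.
move=> Pmu Hh cmu; rewrite /payoff_prior ler_pdivlMr// /prior_likelihood mulr_sumr.
rewrite big_seq [leRHS]big_seq; apply: ler_sum => wF wFmu; have [w0 eF] := prior_all Pmu _ wFmu.
by rewrite mulrC ler_wpM2l ?mulr_ge0 ?likelihood_ge0//; exact: payoff_stop.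
Qed.

Lemma perf_ratio_ge p (r : R) : decision_rule p -> 0 < r ->
  (forall q F h, decision_rule q -> environment X F -> history X x0 h ->
    r * payoff delta q F h <= payoff delta p F h) ->
  (r%:E <= perf_ratio delta p X x0 (env_all X))%E.
Proof.
move=> dp r0 rq; apply: le_ereal_inf_tmp => _ [h [mu [Hh Pmu cmu ->]]].
have qp q : decision_rule q ->
    payoff_prior delta q mu h <= r^-1 * payoff_prior delta p mu h.
  move=> dq; apply: payoff_prior_le => // F eF.
  by rewrite -ler_pdivrMl// ?invr_gt0// invrK rq.
rewrite lee_fin /value_prior; set S := ereal_sup _.
have Sub : (S <= (r^-1 * payoff_prior delta p mu h)%:E)%E.
  by apply: ge_ereal_sup => _ [q dq <-]; rewrite lee_fin qp.
(* Stopping at once earns at least [x0 > 0]. With the upper bound this makes the value a positive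
   real, so [fine] loses nothing and the division is legitimate. *)
have Slb : (x0%:E <= S)%E.
  apply: (@le_trans _ _ (payoff_prior delta (fun _ => 1) mu h)%:E).
    rewrite lee_fin (le_trans _ (best_le_payoff_prior_stop mu h Pmu Hh cmu))//.
    by have /andP[] := history_best x0b X0b Hh.
  by apply: ereal_sup_ubound; exists (fun _ => 1) => //; exact: stop_decision.
case: S Sub Slb => [s|//|//]; rewrite !lee_fin /= => Sub Slb.
have s0 : 0 < s by rewrite (lt_le_trans _ Slb)//; case/andP: x0b.
by rewrite ler_pdivlMr// -ler_pdivlMl.
Qed.

(** Tests the ratio on the prior concentrated at [F]. The positive likelihood makes it consistent
    with [h], and the value is at least what [q] earns. *)
Lemma perf_ratio_single {p q F h} (r : R) : decision_rule p -> decision_rule q ->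
  environment X F -> history X x0 h -> 0 < likelihood F h -> 0 <= r ->
  0 < payoff delta q F h ->
  (r%:E <= perf_ratio delta p X x0 (env_all X))%E ->
  r * payoff delta q F h <= payoff delta p F h.
Proof.
move=> dp dq eF Hh LF r0 q0 rp.
pose mu : seq (R * distr R) := [:: (1, F)].
have payoff1 p' : payoff_prior delta p' mu h = payoff delta p' F h.
  rewrite /payoff_prior /prior_likelihood !big_seq1/= !mul1r mulrAC divff ?mul1r//.
  by rewrite gt_eqF.
have /(le_trans rp) : (perf_ratio delta p X x0 (env_all X)
    <= (payoff_prior delta p mu h / value_prior delta mu h)%:E)%E.
  apply: ereal_inf_lbound; exists h, mu; split => //.
    split; last by rewrite big_seq1.
    by rewrite /= andbT; apply/asboolP; split.
  by rewrite /consistent /prior_likelihood big_seq1/= mul1r.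
rewrite payoff1 lee_fin /value_prior; set S := ereal_sup _.
have Sub : (S <= b%:E)%E.
  apply: ge_ereal_sup => _ [q' dq' <-]; rewrite payoff1 lee_fin.
  by apply: payoff_le => // k; exact: trunc_payoff_le.
have Slb : ((payoff delta q F h)%:E <= S)%E.
  by apply: ereal_sup_ubound; exists q => //; rewrite payoff1.
case: S Sub Slb => [s|//|//]; rewrite !lee_fin /= => Sub Slb.
rewrite ler_pdivlMr; last exact: lt_le_trans Slb.
by apply: le_trans; rewrite ler_wpM2l.
Qed.

End Payoff.

(** * Lower bound *)

(** Removes truncation: bounds for [k] rounds are obtained up to a factor [1 - t ^+ k], and [k]
    tends to infinity. *)
Lemma ge_of_geometric {R : realType} (t g U : R) : 0 <= t < 1 ->
  (forall k, (1 - t ^+ k) * g <= U) -> g <= U.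
Proof.
move=> /andP[t0 t1] gU.
have : (fun k => (1 - t ^+ k) * g) @ \oo --> (1 - 0) * g.
  apply: cvgMl; apply: cvgB; first exact: cvg_cst.
  by apply: cvg_expr; rewrite ger0_norm.
rewrite subr0 mul1r => ug; rewrite -(cvg_lim _ ug)//.
apply: limr_le; first by apply/cvg_ex; exists g.
by apply: nearW => k; exact: gU.
Qed.

Section Bellman.
Context {R : realType} (delta b : R).
Hypotheses (d01 : 0 < delta < 1) (b0 : 0 < b).

Definition guarantee (c y : R) : R := rho (y / b) * Num.max y c.

(** The coefficient [B] of the minorant. For [y < c] it solves [(1 - rho) B c = rho (c - y)], which
    is what the identity [qstar_bellman] requires. *)
Definition guarantee_slope (c y : R) : R :=
  if y < c then rho (y / b) * (c - y) / ((1 - rho (y / b)) * c) else 0.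

Lemma guarantee_slope_ge0 c y : 0 <= y -> c <= b -> 0 <= guarantee_slope c y.
Proof.
move=> y0 cb; rewrite /guarantee_slope; case: ifPn => // yc.
have r1 : rho (y / b) < 1.
  by rewrite rho_lt1 ?divr_ge0 ?(ltW b0)// ltr_pdivrMr//; lra.
have r0 : 0 <= rho (y / b).
  by rewrite /rho addr_ge0 ?divr_ge0// addr_ge0 ?sqrtr_ge0 ?divr_ge0 ?(ltW b0).
by rewrite divr_ge0// mulr_ge0//; lra.
Qed.

Lemma guarantee_subsolution y z c : 1 / 6 <= y / b -> y <= b -> 0 <= z <= b ->
  0 <= c ->
  guarantee c y + guarantee_slope c y * (Num.max z c - c)
    <= guarantee c (Num.max y z).
Proof.
move=> y16 yb /andP[z0 zb] c0; rewrite /guarantee /guarantee_slope.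
have b0' : 0 <= b^-1 by rewrite invr_ge0 ltW.
have y0 : 0 < y by have := y16; rewrite ler_pdivlMr//; have := b0; lra.
have := rho_max_subsolution (y / b) (z / b) (c / b).
rewrite y16 !ler_pdivrMr// !mul1r yb zb !divr_ge0 ?(ltW b0)//.
move=> /(_ isT isT isT).
rewrite ltr_pM2r ?invr_gt0// -!maxr_pMl// => h.
rewrite -(ler_pM2r b0) in h; apply: le_trans (le_trans h _); last first.
  by rewrite le_eqVlt; apply/orP; left; apply/eqP; field; rewrite gt_eqF.
rewrite le_eqVlt; apply/orP; left; apply/eqP.
case: ifPn => yc; last by field; rewrite gt_eqF.
have c0' : c != 0.
  by rewrite gt_eqF// (lt_trans y0).
(* Since [c] may exceed [b] here, [y = b < c] is possible. Then [rho] is 1, and the slopes on both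
   sides are divisions by zero, hence 0. *)
have [->|r1] := eqVneq (1 - rho (y / b)) 0.
  by rewrite !mul0r !invr0 !mulr0; field; rewrite gt_eqF.
by field; rewrite c0' r1 gt_eqF.
Qed.

(* The policy makes [guarantee] a fixed point of the lower bound on the Bellman
   operator provided by [guarantee_subsolution]. *)
Lemma qstar_bellman y c : 0 < y -> y <= b -> 0 <= c <= b ->
  qstar delta (y / b) * y + (1 - qstar delta (y / b)) *
    (delta * guarantee c y + guarantee_slope c y * c * (1 - delta))
  = guarantee c y.
Proof.
move=> y0 yb /andP[c0 cb]; case/andP: (d01) => d0 d1.
have yb0 : 0 <= y / b by rewrite divr_ge0// ltW.
have yb1 : y / b <= 1 by rewrite ler_pdivrMr// mul1r.
have r1 := rho_le1 _ yb0 yb1.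
rewrite qstar_rho// /guarantee /guarantee_slope; set r := rho _ in r1 *.
have D0 : 1 - delta * r != 0 by rewrite gt_eqF//; nra.
case: ifPn => yc; last by rewrite (max_idPl _) ?leNgt//; field.
have r1' : 1 - r != 0.
  by rewrite gt_eqF// subr_gt0 rho_lt1// ltr_pdivrMr//; lra.
have c0' : c != 0 by rewrite gt_eqF//; lra.
by rewrite (max_idPr (ltW yc)); field; rewrite r1' c0' D0.
Qed.

(** The lower bound keeps the rule from waiting forever and yields the geometric rate in
    [trunc_payoff_guarantee]. *)
Lemma qstar_bounds y : 0 <= y <= 1 -> (1 - delta) / 2 <= qstar delta y <= 1.
Proof.
move=> /andP[y0 y1]; case/andP: (d01) => d0 d1; rewrite qstar_rho//.
have r1 := rho_le1 _ y0 y1.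
have rg : 1 / 2 <= rho y by rewrite /rho lerDl divr_ge0// addr_ge0// sqrtr_ge0.
have D0 : 0 < 1 - delta * rho y by nra.
rewrite ler_pdivlMr// ler_pdivrMr// mul1r; apply/andP; split; last by nra.
have Dr : (1 - delta * rho y) / 2 <= rho y by nra.
have : (1 - delta) * ((1 - delta * rho y) / 2) <= (1 - delta) * rho y.
  by rewrite ler_wpM2l//; lra.
by lra.
Qed.

End Bellman.

Section LowerBound.
Context {R : realType} (delta : R).
Hypothesis d01 : 0 < delta < 1.
Context {X : set R}.
Hypothesis mX : measurable X.
Context {x0 b : R}.
Hypotheses (x0b : 0 < x0 <= b) (X0b : X `<=` [set x | 0 <= x <= b]).
Hypothesis x016 : 1 / 6 <= x0 / b.
Context {p : seq R -> R}.
Hypotheses (dp : decision_rule p)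
  (pq : forall h, history X x0 h -> p h = qstar delta (best_so_far h / b)).

Let b0 : 0 < b. Proof. by have /andP[/lt_le_trans] := x0b; apply. Qed.

(** Induction on [k]. Truncation leaves the immediate stopping term [q * y] intact, and this term is
    at least a share [eta] of the guarantee, so each further round multiplies the relative loss by
    [1 - eta]. *)
Lemma trunc_payoff_guarantee F c : environment X F -> 0 <= c <= b ->
  delta * mean_max F c = c -> forall k h, history X x0 h ->
  (((1 - (1 - (1 - delta) * x0 / (2 * b)) ^+ k) * guarantee b c (best_so_far h))%:E
   <= trunc_payoff delta p F k h)%E.
Proof.
move=> [FX iF] /andP[c0 cb] cE; case/andP: (d01) => d0 d1; case/andP: (x0b) => x00 x0b'.
(* Chosen so that [q >= (1 - delta) / 2], [y >= x0] and [guarantee <= b] give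
   [eta * guarantee <= q * y]. *)
set eta := (1 - delta) * x0 / (2 * b).
have eta01 : 0 <= eta <= 1.
  rewrite divr_ge0 ?mulr_ge0 ?subr_ge0 ?(ltW d1) ?(ltW b0) ?(ltW x00)//=.
  by rewrite ler_pdivrMr ?mulr_gt0// mul1r; nra.
elim=> [|k IH] h Hh.
  by rewrite expr0 subrr mul0r trunc_payoff_ge0.
have /andP[xy yb] := history_best x0b X0b Hh.
rewrite /= (pq _ Hh) exprS; set y := best_so_far h in xy yb *.
have y0 : 0 < y by lra.
have yb16 : 1 / 6 <= y / b by rewrite (le_trans x016)// ler_pM2r// invr_gt0.
have yb1 : y / b <= 1 by rewrite ler_pdivrMr// mul1r.
have /andP[q0 q1] := qstar_bounds delta d01 (y / b) ltac:(apply/andP; split => //; lra).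
have := qstar_bellman delta b d01 b0 y c y0 yb ltac:(by apply/andP).
have slope0 := guarantee_slope_ge0 b b0 c y (ltW y0) cb.
set q := qstar _ _ in q0 q1 *; set lam := _ ^+ k.
have lam01 : 0 <= lam <= 1 by rewrite exprn_ge0 ?exprn_ile1//=; lra.
have A0 : 0 <= guarantee b c y <= b.
  have r0 := rho_ge _ yb16; have r1 := rho_le1 _ (ltac:(lra) : 0 <= y / b) yb1.
  rewrite mulr_ge0 ?le_max ?(ltW y0)//=; last lra.
  rewrite -[leRHS]mul1r ler_pM ?le_max ?(ltW y0) ?ge_max ?yb//; lra.
have IHk : (((1 - lam) * (guarantee b c y
      + guarantee_slope b c y * (mean_max F c - c)))%:E
    <= \int[F]_x trunc_payoff delta p F k (rcons h x))%E.
  have -> : (1 - lam) * (guarantee b c y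
      + guarantee_slope b c y * (mean_max F c - c))
    = (1 - lam) * (guarantee b c y - guarantee_slope b c y * c)
      + (1 - lam) * guarantee_slope b c y * mean_max F c by ring.
  rewrite -integral_affine_max//.
  apply: (le_integral_full F mX FX) => x Xx.
    rewrite lee_fin -mulrA -mulrDr mulr_ge0//; first by lra.
    have : c <= Num.max x c by rewrite le_max lexx orbT.
    by nra.
  have xb := X0b x Xx; have /andP[xx0 _] := xb.
  apply: le_trans (IH _ (history_rcons Hh Xx)).
  rewrite best_rcons// -/y lee_fin -mulrA -mulrDr ler_wpM2l//; first by lra.
  by have := guarantee_subsolution b b0 y x c yb16 yb xb c0; lra.
move=> bell.
have q0' : 0 <= (1 - q) * delta by rewrite mulr_ge0 ?subr_ge0 ?(ltW d0).
apply: (@le_trans _ _ ((q * y)%:E + ((1 - q) * delta)%:E *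
  ((1 - lam) * (guarantee b c y + guarantee_slope b c y * (mean_max F c - c)))%:E)%E);
  last by rewrite leeD2l// lee_wpmul2l.
rewrite -EFinM -EFinD lee_fin {IHk}.
have -> : (1 - q) * delta * ((1 - lam) *
   (guarantee b c y + guarantee_slope b c y * (mean_max F c - c)))
  = (1 - lam) * ((1 - q) * (delta * guarantee b c y
     + guarantee_slope b c y * (delta * mean_max F c - delta * c))) by ring.
(* The reservation equation eliminates the environment: only [c] remains, in the form needed by
   [qstar_bellman]. *)
rewrite cE (_ : c - delta * c = c * (1 - delta)); last by ring.
have {}bell : (1 - q) * (delta * guarantee b c y
  + guarantee_slope b c y * (c * (1 - delta))) = guarantee b c y - q * y by lra.
rewrite bell.
have etaq : eta * guarantee b c y <= q * y.
  have : eta * guarantee b c y <= eta * b by rewrite ler_wpM2l//; lra.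
  have -> : eta * b = (1 - delta) / 2 * x0 by rewrite /eta; field; rewrite gt_eqF.
  by move=> /le_trans; apply; apply: ler_pM => //; lra.
by nra.
Qed.

(** Both payoffs are compared with [max y c], and [rho] increases from [x0] to the best-so-far
    alternative. *)
Lemma payoff_guarantee q F h : decision_rule q -> environment X F ->
  history X x0 h ->
  rho (x0 / b) * payoff delta q F h <= payoff delta p F h.
Proof.
move=> dq eF Hh; case/andP: (d01) => d0 d1; case/andP: (x0b) => x00 x0b'.
have [c cb cE] := environment_reservation delta d01 mX x0b X0b F eF.
have /andP[c0 cb'] := cb.
have /andP[xy yb] := history_best x0b X0b Hh.
have x0b0 : 0 <= x0 / b by have := x016; lra.
apply: (@le_trans _ _ (guarantee b c (best_so_far h))).
  apply: ler_pM; rewrite ?(payoff_ge0 _ d01 mX x0b X0b)//.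
  - by have := rho_ge _ x016; lra.
  - by rewrite rho_le// ler_pM2r// invr_gt0.
  - apply: (payoff_le _ d01 mX x0b X0b) => // k.
    exact: (trunc_payoff_ub delta d01 mX X0b dq eF c0 cE k h Hh).
apply: (ge_of_geometric (1 - (1 - delta) * x0 / (2 * b))) => [|k].
  apply/andP; split; last by rewrite ltrBlDr ltrDl divr_gt0 ?mulr_gt0// subr_gt0.
  by rewrite subr_ge0 ler_pdivrMr ?mulr_gt0// mul1r; nra.
rewrite -lee_fin; apply: le_trans (trunc_payoff_le_payoff _ d01 mX x0b X0b k dp eF Hh).
exact: trunc_payoff_guarantee.
Qed.

End LowerBound.

(** * Upper bound *)

Section TwoPoint.
Context {R : realType} (theta v : R).

Definition two_point_rv (t : bool) : R := if t then v else 0.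

Lemma measurable_two_point_rv : measurable_fun setT two_point_rv.
Proof. by []. Qed.

HB.instance Definition _ :=
  @isMeasurableFun.Build _ _ _ _ two_point_rv measurable_two_point_rv.

Definition two_point : distr R := distribution (bernoulli_prob theta) two_point_rv.

Hypothesis theta01 : 0 <= theta <= 1.

Lemma two_pointE (A : set R) :
  two_point A = (theta * \1_A v + (1 - theta) * \1_A 0)%:E.
Proof. by rewrite /two_point /distribution /pushforward/= bernoulli_probE. Qed.

Lemma integral_two_point (f : R -> \bar R) :
  (0 <= f v)%E -> (0 <= f 0%R)%E ->
  (\int[two_point]_x f x = theta%:E * f v + (1 - theta)%:E * f 0%R)%E.
Proof.
move=> fv f0.
(* [f] need not be measurable; [g] is, and it agrees with [f] on the support. *)
pose g x := if x == v then f v else if x == 0 then f 0 else 0%E.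
have mA : measurable [set v; 0 : R] by exact: measurableU.
have A0 : two_point (~` [set v; 0]) = 0%E.
  by rewrite two_pointE !indicE !memNset ?mulr0 ?addr0//= => h; apply: h; [right|left].
rewrite (eq_integral_full two_point mA A0 f g); last first.
  move=> x [->|->]; rewrite /g eqxx//; by case: eqP => // ->.
rewrite ge0_integral_distribution; last 2 first.
- apply: measurable_fun_ifT => //; first exact: measurable_fun_eqr.
  by apply: measurable_fun_ifT => //; exact: measurable_fun_eqr.
- by move=> y; rewrite /g; case: ifP => // _; case: ifP.
rewrite integral_bernoulli_prob//; last first.
  by move=> y; rewrite /= /g; case: ifP => // _; case: ifP.
by rewrite /= /g eqxx /two_point_rv /= eqxx; case: eqP => // ->.
Qed.

Lemma environment_two_point (X : set R) : X 0 -> X v -> environment X two_point.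
Proof.
move=> X0 Xv; split.
  by rewrite two_pointE !indicE !memNset ?mulr0 ?addr0//= => h; exact: h.
apply/integrableP; split; first exact/measurable_EFinP.
by rewrite integral_two_point/= ?lee_fin// -!EFinM -EFinD ltry.
Qed.

Lemma likelihood_two_point (x0 : R) t : v != 0 -> theta < 1 ->
  0 < likelihood two_point (x0 :: nseq t 0).
Proof.
move=> v0 t1; rewrite /likelihood/=; elim: t => [|t IH]; first by rewrite big_nil.
have v00 : (v \in [set 0 : R]) = false by apply/memNset => /eqP; exact/negP.
have z00 : ((0 : R) \in [set 0 : R]) = true by exact/mem_set.
rewrite /= big_cons mulr_gt0// [X in fine X]two_pointE /= !indicE v00 z00.
by rewrite mulr0 add0r mulr1 subr_gt0.
Qed.

Lemma trunc_payoff_two_point (delta : R) (p : seq R -> R) k h :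
  0 < delta < 1 -> decision_rule p ->
  trunc_payoff delta p two_point k.+1 h
  = ((p h * best_so_far h)%:E + ((1 - p h) * delta)%:E *
      (theta%:E * trunc_payoff delta p two_point k (rcons h v)
       + (1 - theta)%:E * trunc_payoff delta p two_point k (rcons h 0%R)))%E.
Proof. by move=> d01 dp; rewrite /= integral_two_point// trunc_payoff_ge0. Qed.

End TwoPoint.

Section Threshold.
Context {R : realType} (delta : R) (v : R).
Hypotheses (d01 : 0 < delta < 1) (v0 : 0 < v).

Definition threshold_rule (h : seq R) : R := if v <= best_so_far h then 1 else 0.

Lemma threshold_decision : decision_rule threshold_rule.
Proof. by move=> h; rewrite /threshold_rule; case: ifP => _; rewrite lexx ler01. Qed.

(** [V] solves [V = delta (theta v + (1 - theta) V)], the value of waiting for [v]. Truncation costs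
    the factor lost when [v] fails to appear for [k] rounds. *)
Lemma trunc_payoff_threshold (theta : R) : 0 <= theta <= 1 ->
  let V := delta * theta * v / (1 - delta * (1 - theta)) in
  forall k h, (((1 - (delta * (1 - theta)) ^+ k) * V)%:E
    <= trunc_payoff delta threshold_rule (two_point theta v) k h)%E.
Proof.
move=> t01 V; case/andP: (d01) => d0 d1; case/andP: (t01) => t0 t1.
have D0 : 0 < 1 - delta * (1 - theta) by nra.
have b01 : 0 <= delta * (1 - theta) <= 1.
  by rewrite mulr_ge0 ?(ltW d0) ?subr_ge0//=; lra.
have V0 : 0 <= V by rewrite divr_ge0 ?mulr_ge0 ?(ltW d0) ?(ltW D0) ?(ltW v0).
have Vv : V <= v.
  have : 0 <= v * (1 - delta) by rewrite mulr_ge0 ?subr_ge0 ?(ltW d1) ?(ltW v0).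
  by rewrite ler_pdivrMr//; lra.
have stop k h : v <= best_so_far h ->
    (((1 - (delta * (1 - theta)) ^+ k) * V)%:E
    <= (best_so_far h)%:E)%E.
  move=> vh; rewrite lee_fin (le_trans _ vh)// (le_trans _ Vv)// ler_piMl//.
  by rewrite gerBl exprn_ge0//; case/andP: b01.
have stopE k h : v <= best_so_far h ->
    trunc_payoff delta threshold_rule (two_point theta v) k h = (best_so_far h)%:E.
  move=> vh; case: k => [|k] /=; rewrite /threshold_rule vh ?mul1r//.
  by rewrite subrr mul0r mul0e adde0.
elim=> [|k IH] h.
  by rewrite expr0 subrr mul0r trunc_payoff_ge0//; exact: threshold_decision.
have [vh|hv] := leP v (best_so_far h); first by rewrite stopE// stop.
rewrite trunc_payoff_two_point//; last exact: threshold_decision.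
have -> : threshold_rule h = 0 by rewrite /threshold_rule leNgt hv.
rewrite mul0r add0e subr0 mul1r.
have vb : v <= best_so_far (rcons h v).
  by rewrite best_rcons ?le_max ?lexx ?orbT// ltW.
rewrite (stopE _ _ vb).
apply: (@le_trans _ _ (delta%:E * (theta%:E * v%:E + (1 - theta)%:E *
   ((1 - (delta * (1 - theta)) ^+ k) * V)%:E))%E); last first.
  rewrite lee_wpmul2l ?lee_fin ?(ltW d0)// leeD//.
    by rewrite lee_wpmul2l ?lee_fin.
  by rewrite lee_wpmul2l ?lee_fin ?subr_ge0.
rewrite -!EFinM lee_fin le_eqVlt; apply/orP; left; apply/eqP.
rewrite exprS; set e := _ ^+ k.
have VE : V = delta * theta * v + delta * (1 - theta) * V.
  by rewrite /V; field; rewrite gt_eqF.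
transitivity (V - delta * (1 - theta) * e * V); first by ring.
by rewrite {1}VE; ring.
Qed.

End Threshold.

(* The supremum over [t] of [alpha * A t + B t] is bounded by the better of
   stopping and continuing, whence the disjunction.  Weights independent of [t]
   suffice even though [p] may be non-stationary. *)
Lemma two_environments {R : realType} (delta theta x b alpha LA LB : R)
    (p A B : nat -> R) :
  0 < delta < 1 -> 0 <= alpha ->
  (forall t, 0 <= p t <= 1) -> (forall t, LA <= A t <= b) ->
  (forall t, LB <= B t <= b) -> 0 <= theta ->
  (forall t, A t <= p t * x + (1 - p t) * delta * A t.+1) ->
  (forall t, B t <= p t * x
     + (1 - p t) * delta * (theta * b + (1 - theta) * B t.+1)) ->
  alpha * LA + LB <= (alpha + 1) * x \/
  (1 - delta) * (alpha * LA + LB) <= delta * theta * (b - LB).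
Proof.
move=> /andP[d0 d1] a0 p01 Ab Bb t0 Arec Brec.
pose Z := range (fun t => alpha * A t + B t).
have hZ : has_sup Z.
  split; first by exists (alpha * A 0%N + B 0%N); exists 0%N.
  exists (alpha * b + b) => _ [t _ <-]; apply: lerD; last by case/andP: (Bb t).
  by rewrite ler_wpM2l//; case/andP: (Ab t).
have leZ t : alpha * A t + B t <= sup Z by apply: ub_le_sup (proj2 hZ) _ _; exists t.
have Zlb : alpha * LA + LB <= sup Z.
  apply: le_trans (leZ 0%N); apply: lerD; last by case/andP: (Bb 0%N).
  by rewrite ler_wpM2l//; case/andP: (Ab 0%N).
have : sup Z <= Num.max ((alpha + 1) * x) (delta * sup Z + delta * theta * (b - LB)).
  apply: ge_sup (proj1 hZ) _ => _ [t _ <-].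
  set M := Num.max _ _.
  have M1 : (alpha + 1) * x <= M by rewrite le_max lexx.
  have M2 : delta * sup Z + delta * theta * (b - LB) <= M by rewrite le_max lexx orbT.
  have /andP[p0 p1] := p01 t.
  have AM : alpha * A t <= alpha * (p t * x + (1 - p t) * delta * A t.+1).
    by rewrite ler_wpM2l.
  (* Drawing the good alternative improves on [B t.+1] by [b - B t.+1], which is at most
     [b - LB]. *)
  have BL : delta * (alpha * A t.+1 + B t.+1 + theta * (b - B t.+1)) <= M.
    apply: le_trans M2; rewrite -mulrA -mulrDr ler_wpM2l ?(ltW d0)// lerD//.
    by rewrite ler_wpM2l// lerD2l lerN2; case/andP: (Bb t.+1).
  have : p t * ((alpha + 1) * x) <= p t * M by rewrite ler_wpM2l.
  have : (1 - p t) * (delta * (alpha * A t.+1 + B t.+1 + theta * (b - B t.+1)))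
    <= (1 - p t) * M by rewrite ler_wpM2l// subr_ge0.
  by have := Brec t; move: AM; lra.
rewrite le_max => /orP[h|h]; [left|right]; first exact: le_trans h.
have : (1 - delta) * (alpha * LA + LB) <= (1 - delta) * sup Z.
  by rewrite ler_wpM2l// subr_ge0 ltW.
by move: h; lra.
Qed.

Lemma lt_EFin_ex {R : realType} (r : R) (y : \bar R) :
  (r%:E < y)%E -> exists2 s : R, r < s & (s%:E <= y)%E.
Proof.
case: y => [s|_|//]; first by rewrite lte_fin => rs; exists s.
by exists (r + 1); rewrite ?ltrDl ?leey.
Qed.

Section UpperBound.
Context {R : realType} (delta : R).
Hypothesis d01 : 0 < delta < 1.
Context {X : set R}.
Hypotheses (mX : measurable X) (X0 : X 0).
Context {x0 b : R}.
Hypotheses (x0b : 0 < x0 <= b) (X0b : X `<=` [set x | 0 <= x <= b]).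
Context {p : seq R -> R}.
Hypothesis dp : decision_rule p.

(** Once [v] has appeared, the continuation is bounded crudely by [b]. Thus only histories of zeros
    have to be followed. *)
Lemma payoff_two_point_le {theta v : R} {h : seq R} : 0 <= theta <= 1 -> X v ->
  history X x0 h ->
  payoff delta p (two_point theta v) h <= p h * best_so_far h + (1 - p h) * delta *
    (theta * b + (1 - theta) * payoff delta p (two_point theta v) (rcons h 0)).
Proof.
move=> t01 Xv Hh; have eF := environment_two_point theta v t01 X X0 Xv.
have /andP[p0 p1] := dp h; have /andP[t0 t1] := t01; have /andP[d0 d1] := d01.
have H0 := history_rcons Hh X0; have Hv := history_rcons Hh Xv.
have b0 : 0 <= b by have /andP[/ltW/le_trans] := x0b; apply.
apply: (payoff_le _ d01 mX x0b X0b) => // -[|k].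
  rewrite /= lee_fin lerDl !mulr_ge0 ?subr_ge0 ?(ltW d0)//.
  by rewrite addr_ge0 ?mulr_ge0 ?subr_ge0// (payoff_ge0 _ d01 mX x0b X0b).
rewrite trunc_payoff_two_point// [leRHS]EFinD leeD2l// [leRHS]EFinM lee_wpmul2l//.
  by rewrite lee_fin mulr_ge0 ?subr_ge0 ?(ltW d0).
rewrite [leRHS]EFinD !EFinM leeD// lee_wpmul2l ?lee_fin ?subr_ge0//.
  exact: (trunc_payoff_le _ d01 mX x0b X0b dp eF k _ Hv).
exact: (trunc_payoff_le_payoff _ d01 mX x0b X0b k dp eF H0).
Qed.

Lemma history_zeros t : history X x0 (x0 :: nseq t 0).
Proof.
exists (nseq t 0); split => //; apply/allP => x /nseqP[-> _].
exact/asboolP.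
Qed.

Lemma rcons_zeros t : rcons (x0 :: nseq t 0) 0 = x0 :: nseq t.+1 0.
Proof. by rewrite rcons_cons -cats1 cat_nseq -[t.+1]addn1 nseqD cat_nseq. Qed.

Lemma best_zeros t : best_so_far (x0 :: nseq t 0) = x0.
Proof.
have x00 : 0 <= x0 by case/andP: x0b => /ltW.
elim: t => [|t IH]; last by rewrite -rcons_zeros best_rcons// IH; exact/max_idPl.
by rewrite /best_so_far/= big_cons big_nil; exact/max_idPl.
Qed.

(** Under the point mass at 0, stopping at once earns [x0], while the rule cannot exceed
    [rho (x0 / b) * x0], the fixed point of its recursion. *)
Lemma perf_ratio_qstar_le :
  (forall h, history X x0 h -> p h = qstar delta (best_so_far h / b)) ->
  (perf_ratio delta p X x0 (env_all X) <= (rho (x0 / b))%:E)%E.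
Proof.
move=> pq; have /andP[x00 x0b'] := x0b; have /andP[d0 d1] := d01.
have b0 : 0 < b by lra.
have xb0 : 0 <= x0 / b by rewrite divr_ge0 ?ltW.
have xb1 : x0 / b <= 1 by rewrite ler_pdivrMr// mul1r.
set r := rho _; rewrite leNgt; apply/negP => /lt_EFin_ex[s rs sp].
have r1 : r <= 1 := rho_le1 _ xb0 xb1.
have r0 : 1 / 2 < r by apply: half_lt_rho; rewrite divr_gt0.
have t01 : 0 <= (0 : R) <= 1 by rewrite lexx ler01.
have eD := environment_two_point 0 0 t01 X X0 X0.
have H0 := history_zeros 0%N.
have stop0 : x0 <= payoff delta (fun _ => 1) (two_point 0 0) [:: x0].
  have := payoff_stop delta d01 mX x0b X0b eD H0.
  by rewrite (best_zeros 0%N).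
have := perf_ratio_single delta d01 mX x0b X0b s dp stop_decision eD H0.
rewrite /likelihood/= big_nil => /(_ ltr01 _ _ sp) h.
have {h} : s * x0 <= payoff delta p (two_point 0 0) [:: x0].
  apply: le_trans (h _ _); rewrite ?(lt_le_trans _ stop0)//; last by lra.
  by rewrite ler_pM2l//; lra.
suff : payoff delta p (two_point 0 0) [:: x0] <= r * x0.
  move=> /[swap] /le_trans /[apply]; rewrite ler_pM2r//; lra.
apply: (payoff_le _ d01 mX x0b X0b) => // k.
have {H0} : forall t, (trunc_payoff delta p (two_point 0%R 0%R) k (x0 :: nseq t 0%R)
    <= (r * x0)%:E)%E; last by move=> /(_ 0%N).
elim: k => [|k IH] t.
all: have Hh := history_zeros t; have /andP[p0 p1] := dp (x0 :: nseq t 0).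
all: have qE := pq _ Hh; rewrite best_zeros qstar_rho// -/r in qE.
all: have D0 : 0 < 1 - delta * r by nra.
  rewrite /= best_zeros lee_fin ler_pM2r// qE ler_pdivrMr//.
  by rewrite ler_pM2l ?lerD2l ?lerN2 ?ler_piMr ?(ltW d0)//; lra.
rewrite trunc_payoff_two_point// best_zeros mul0e add0e subr0 mul1e.
rewrite rcons_zeros.
apply: (@le_trans _ _ ((p (x0 :: nseq t 0%R) * x0)%:E
  + ((1 - p (x0 :: nseq t 0%R)) * delta)%:E * (r * x0)%:E)%E).
  by rewrite leeD2l// lee_wpmul2l// lee_fin mulr_ge0 ?subr_ge0 ?(ltW d0).
rewrite -EFinM -EFinD lee_fin le_eqVlt; apply/orP; left; apply/eqP.
by rewrite qE; field; rewrite gt_eqF.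
Qed.

Hypothesis b_sup : forall e, e < b -> exists2 v, X v & e < v.
Hypothesis x0delta : x0 / b <= delta ^+ 2 / (2 - delta).

(* The adversary hides the good environment [two_point theta v], with [v] close
   to [b], behind the worthless one.  The optimal [theta] would be
   [w (1 - delta) / ((1 - r) delta)], which the hypothesis on [x0 / b] keeps
   at most 1; the factor [k] makes it less than 1, so that histories of zeros
   stay consistent. *)
Lemma perf_ratio_le : (perf_ratio delta p X x0 (env_all X) <= (rho (x0 / b))%:E)%E.
Proof.
have /andP[x00 x0b'] := x0b; have /andP[d0 d1] := d01.
have b0 : 0 < b by lra.
pose x := x0 / b; have xE : x0 = b * x by rewrite /x mulrC divfK// gt_eqF.
have x_gt0 : 0 < x by rewrite divr_gt0.
have xd : x * (2 - delta) <= delta ^+ 2 by rewrite -ler_pdivlMr//; lra.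
have x_lt1 : x < 1 by nra.
rewrite -/x; clearbody x; set r := rho x; rewrite leNgt; apply/negP => /lt_EFin_ex[s rs sp].
have r1 : r < 1 := rho_lt1 _ (ltW x_gt0) x_lt1.
have r0 : 1 / 2 < r := half_lt_rho _ x_gt0.
pose w := 2 * r - 1; have wx : w ^+ 2 = r * x := rho_quadratic _ (ltW x_gt0).
have w0 : 0 < w by rewrite /w; lra.
have wx' : x <= w.
  by rewrite -(ler_pM2l w0) -expr2 wx ler_pM2r// /w; lra.
(* The bound on [x0 / b] restated for [r]; it is equivalent to the optimal [theta] being at most
   1. *)
have rd : r * (2 - delta) <= 1.
  rewrite leNgt; apply/negP => rd.
  have : r * (x * (2 - delta)) <= r * delta ^+ 2 by rewrite ler_wpM2l//; lra.
  rewrite mulrA -wx /w; nra.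
(* By the inequality of arithmetic and geometric means, [k ^+ 2 > r / s]. One factor [k] pays for
   lowering [theta], the other for [v] falling short of [b]. *)
pose k := (1 + r / s) / 2.
have s0 : 0 < s by lra.
have rs1 : r / s < 1 by rewrite ltr_pdivrMr// mul1r.
have rs0 : 0 < r / s by rewrite divr_gt0//; lra.
have k1 : k < 1 by rewrite /k; lra.
have k0 : 0 < k by rewrite /k; lra.
have ks : r < s * k ^+ 2.
  by rewrite mulrC -ltr_pdivrMr// /k; nra.
pose theta := k * (w * (1 - delta) / ((1 - r) * delta)).
have th0 : 0 < theta by rewrite !mulr_gt0 ?invr_gt0 ?mulr_gt0//; lra.
have th1 : theta < 1.
  apply: (@le_lt_trans _ _ (k * 1)); last by rewrite mulr1.
  rewrite ler_pM2l// ler_pdivrMr ?mul1r; last by rewrite mulr_gt0//; lra.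
  by rewrite /w; nra.
have [v Xv kv] : exists2 v, X v & k * b < v.
  by apply: b_sup; rewrite gtr_pMl.
have /andP[_ vb] := X0b v Xv.
have v0 : 0 < v by rewrite (lt_trans _ kv)// mulr_gt0.
have th01 : 0 <= theta <= 1 by rewrite !ltW.
pose V := delta * theta * v / (1 - delta * (1 - theta)).
have dth : delta * theta = (1 - delta) * (k * w / (1 - r)).
  by rewrite /theta; field; rewrite !gt_eqF; lra.
have VE : V = v * (k * w / (1 - r + k * w)).
  rewrite /V (_ : 1 - delta * (1 - theta) = 1 - delta + delta * theta); last by ring.
  have kw : 0 < k * w by rewrite mulr_gt0.
  by rewrite dth; field; rewrite !gt_eqF//; nra.
(* For [k = 1] and [v = b] the waiting value would be [b * w / r], because [1 - r + w = r]. *)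
have Vb : k ^+ 2 * (b * w / r) <= V.
  rewrite VE; have -> : k ^+ 2 * (b * w / r) = k * b * (k * w / r).
    by rewrite expr2; ring.
  apply: ler_pM; rewrite ?(ltW kv)//; try by rewrite !mulr_ge0 ?invr_ge0//; lra.
  have kw : 0 < k * w by rewrite mulr_gt0.
  rewrite ler_pM2l// lef_pV2 ?posrE; try by lra.
  have : k * w < w by rewrite gtr_pMl.
  by rewrite /w; lra.
have sV : b * w < s * V.
  have : s * (k ^+ 2 * (b * w / r)) <= s * V by rewrite ler_pM2l.
  apply: lt_le_trans.
  have -> : s * (k ^+ 2 * (b * w / r)) = (s * k ^+ 2) / r * (b * w) by ring.
  by rewrite ltr_pMl ?mulr_gt0// ltr_pdivlMr ?mul1r//; lra.
have V0 : 0 < V.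
  by rewrite -(pmulr_rgt0 _ s0) (lt_trans _ sV)// mulr_gt0.
pose h t : seq R := x0 :: nseq t 0.
have hS t : rcons (h t) 0 = h t.+1 by exact: rcons_zeros.
have t01 : 0 <= (0 : R) <= 1 by rewrite lexx ler01.
have eD := environment_two_point 0 v t01 X X0 Xv.
have eF := environment_two_point theta v th01 X X0 Xv.
have le_b F t : environment X F -> payoff delta p F (h t) <= b.
  move=> eG; apply: (payoff_le _ d01 mX x0b X0b) => // [|j].
    exact: history_zeros.
  by apply: (trunc_payoff_le _ d01 mX x0b X0b) => //; exact: history_zeros.
have Alb t : s * x0 <= payoff delta p (two_point 0 v) (h t).
  have stop0 : x0 <= payoff delta (fun _ => 1) (two_point 0 v) (h t).
    have := payoff_stop delta d01 mX x0b X0b eD (history_zeros t).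
    by rewrite best_zeros.
  apply: le_trans (perf_ratio_single delta d01 mX x0b X0b s dp stop_decision eD
    (history_zeros t) _ (ltW s0) _ sp).
  - by rewrite ler_pM2l.
  - by apply: likelihood_two_point => //; rewrite ?gt_eqF.
  - exact: lt_le_trans stop0.
have Blb t : s * V <= payoff delta p (two_point theta v) (h t).
  have dT := threshold_decision v.
  have VT : V <= payoff delta (threshold_rule v) (two_point theta v) (h t).
    apply: (ge_of_geometric (delta * (1 - theta))) => [|j].
      by rewrite mulr_ge0 ?subr_ge0 ?(ltW d0) ?(ltW th1)//=; nra.
    rewrite -lee_fin.
    apply: le_trans (trunc_payoff_le_payoff _ d01 mX x0b X0b j dT eF (history_zeros t)).
    exact: trunc_payoff_threshold.
  apply: le_trans (perf_ratio_single delta d01 mX x0b X0b s dp dT eF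
    (history_zeros t) _ (ltW s0) _ sp).
  - by rewrite ler_pM2l.
  - by apply: likelihood_two_point => //; rewrite ?gt_eqF.
  - exact: lt_le_trans VT.
(* This weight gives [(alpha + 1) * x = 2 * w]. At ratio [r] the weighted guarantees would sum to
   exactly [b * (2 * w)]; with [s > r] they exceed it, whereas both alternatives of
   [two_environments] force them not to. *)
pose alpha := (w - x) / ((1 - r) * x).
have alpha0 : 0 <= alpha by rewrite divr_ge0 ?mulr_ge0 ?subr_ge0// ltW.
have ax : alpha * x * (1 - r) = w - x.
  by rewrite /alpha; field; rewrite !gt_eqF// subr_gt0.
have ax2 : alpha * x + x = 2 * w.
  apply: (@mulIf _ (1 - r)); first by rewrite gt_eqF//; lra.
  by rewrite mulrDl ax mulrBr mulr1 (mulrC x r) -wx /w; ring.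
have gain : b * (2 * w) < alpha * (s * x0) + s * V.
  have : alpha * (r * x0) <= alpha * (s * x0).
    by rewrite ler_wpM2l// ler_pM2r// ltW.
  have -> : alpha * (r * x0) = b * (alpha * x - alpha * x * (1 - r)).
    by rewrite xE; ring.
  by rewrite ax -ax2; move: sV; lra.
have := @two_environments _ delta theta x0 b alpha (s * x0) (s * V) (p \o h)
  (fun t => payoff delta p (two_point 0 v) (h t))
  (fun t => payoff delta p (two_point theta v) (h t)) d01 alpha0.
case=> [t|t|t||t|t||].
- exact: dp.
- by rewrite Alb le_b.
- by rewrite Blb le_b.
- exact: ltW.
- have := payoff_two_point_le t01 Xv (history_zeros t).
  by rewrite best_zeros -/(h t) hS mul0r add0r subr0 mul1r.
- have := payoff_two_point_le th01 Xv (history_zeros t).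
  by rewrite best_zeros -/(h t) hS.
- rewrite leNgt => /negP; apply; apply: le_lt_trans gain.
  by rewrite xE mulrCA mulrDl mul1r ax2.
- rewrite leNgt => /negP; apply.
  apply: (@lt_trans _ _ ((1 - delta) * (b * (2 * w)))); last first.
    by rewrite ltr_pM2l// subr_gt0.
  apply: (@lt_trans _ _ (delta * theta * (b - b * w))).
    by rewrite (ltr_pM2l (mulr_gt0 d0 th0)) ltrD2l ltrN2.
  have -> : delta * theta * (b - b * w) = (1 - delta) * (b * (2 * (k * w))).
    by rewrite dth /w; field; rewrite gt_eqF; lra.
  rewrite !ltr_pM2l// ?subr_gt0//.
  by rewrite gtr_pMl.
Qed.

End UpperBound.

Theorem theorem2 (R : realType) (delta : R) (X : set R) :
  0 < delta < 1 ->
  measurable X -> X `<=` [set x | 0 <= x] -> X 0 -> has_ubound X ->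
  let xbar := sup X in
  (exists L : R, 0 < L < 1 /\
     forall x0 : R, 0 < x0 <= xbar -> L <= x0 / xbar ->
       ((rho (x0 / xbar))%:E <= opt_ratio delta X x0 (env_all X))%E /\
       1 / 2 < rho (x0 / xbar)) /\
  (forall x0 : R, 0 < x0 <= xbar -> 1 / 6 <= x0 / xbar ->
     let pstar := stationary_rule (fun y => qstar delta (y / xbar)) in
     (perf_ratio delta pstar X x0 (env_all X) = (rho (x0 / xbar))%:E /\
      1 / 2 < rho (x0 / xbar)) /\
     (x0 / xbar <= delta ^+ 2 / (2 - delta) ->
        dynamically_robust delta pstar X x0 (env_all X))).
Proof.
move=> d01 mX Xge0 X0 ubX xbar.
have X0b : X `<=` [set x | 0 <= x <= xbar].
  by move=> x Xx; apply/andP; split; [exact: Xge0|exact: ub_le_sup].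
pose pstar := stationary_rule (fun y => qstar delta (y / xbar)).
(* Outside histories in [X] the formula for [pstar] may leave [0,1]. *)
pose p h := if 0 <= pstar h <= 1 then pstar h else 0.
have dp : decision_rule p.
  by move=> h; rewrite /p; case: ifPn => // _; rewrite lexx ler01.
have pE x0 : 0 < x0 <= xbar -> forall h, history X x0 h ->
    p h = qstar delta (best_so_far h / xbar).
  move=> x0b h Hh; have /andP[x00 x0b'] := x0b.
  have /andP[xy yb] := history_best x0b X0b Hh.
  have b0 : 0 < xbar := lt_le_trans x00 x0b'.
  have : 0 <= best_so_far h / xbar <= 1.
    by rewrite divr_ge0 ?best_ge0 ?(ltW b0)//= ler_pdivrMr// mul1r.
  move=> /(qstar_bounds delta d01) /andP[q0 q1].
  rewrite /p /pstar /stationary_rule q1 andbT ifT// (le_trans _ q0)//.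
  by case/andP: d01 => ? ?; lra.
have half x0 : 0 < x0 <= xbar -> 1 / 2 < rho (x0 / xbar).
  by move=> /andP[x00 x0b]; rewrite half_lt_rho// divr_gt0// (lt_le_trans x00).
have perfE x0 : 0 < x0 <= xbar -> 1 / 6 <= x0 / xbar ->
    perf_ratio delta p X x0 (env_all X) = (rho (x0 / xbar))%:E.
  move=> x0b x016; apply/eqP; rewrite eq_le; apply/andP; split.
    exact: (perf_ratio_qstar_le delta d01 mX X0 x0b X0b dp (pE _ x0b)).
  apply: (perf_ratio_ge delta d01 mX x0b X0b) => //.
    by have := half _ x0b; lra.
  move=> q F h dq eF Hh.
  exact: (payoff_guarantee delta d01 mX x0b X0b x016 dp (pE _ x0b)).
have opt_ge x0 : 0 < x0 <= xbar -> 1 / 6 <= x0 / xbar ->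
    ((rho (x0 / xbar))%:E <= opt_ratio delta X x0 (env_all X))%E.
  by move=> x0b x016; rewrite -perfE//; apply: ereal_sup_ubound; exists p.
split; first by exists (1 / 6); split; [lra|move=> x0 x0b x016; split; auto].
move=> x0 x0b x016 /=; rewrite -/pstar.
have pstarE : perf_ratio delta pstar X x0 (env_all X) = (rho (x0 / xbar))%:E.
  rewrite -perfE//; apply: (eq_perf_ratio delta mX) => h Hh.
  by rewrite (pE _ x0b _ Hh).
split; first by split; auto.
move=> x0d; rewrite /dynamically_robust pstarE; apply/eqP; rewrite eq_le opt_ge//=.
apply: ge_ereal_sup => _ [q dq <-].
apply: (perf_ratio_le delta d01 mX X0 x0b X0b dq) => // e eb.
by have [v Xv ev] := sup_gt (ex_intro _ 0 X0) eb; exists v.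
Qed.
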